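(* Let $F$ be a continuous distribution function symmetric about zero, and $G$ a continuous distribution function with zero median; let $\varepsilon_n\in(0,1]$ with $\varepsilon_n\to0$ and $\mu_n>0$. The sign test, which rejects for large values of $S=\sum_{i=1}^n\mathrm{sign}(X_i)$, is asymptotically powerful if $$\sqrt{n}\,\varepsilon_n\,[1/2-G(-\mu_n)]\to\infty,$$ and asymptotically powerless if $$\sqrt{n}\,\varepsilon_n\,[1/2-G(-\mu_n)]\to0.$$
   Context: Testing problem: for each $n$ one observes $X_1,\dots,X_n\in\mathbb{R}$ and tests $H_0^n$: $X_1,\dots,X_n$ are i.i.d. with distribution function $F(x)$, versus $H_1^n$: $X_1,\dots,X_n$ are i.i.d. with distribution function $(1-\varepsilon_n)F(x)+\varepsilon_n G(x-\mu_n)$. Limits are as $n\to\infty$. $F$ symmetric about zero means $F(-x)=1-F(x)$ for all $x$. Signs take values in $\{-1,1\}$ (zero observations have probability zero). A test based on a statistic $S$ is asymptotically powerful (resp. powerless) if the total variation distance between the distribution of $S$ under $H_0^n$ and its distribution under $H_1^n$ tends to $2$ (resp. $0$), with the normalization $\|P-Q\|=2\sup_A|P(A)-Q(A)|$, for which the maximal value is $2$. *)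

(* Defs.v *)
From HB Require Import structures.
From mathcomp Require Import all_boot all_order all_algebra.
From mathcomp Require Import all_classical all_reals all_analysis.
From mathcomp Require Import measurable_realfun.

Set Implicit Arguments.
Unset Strict Implicit.
Unset Printing Implicit Defensive.

Import Order.TTheory GRing.Theory Num.Theory.
Import numFieldNormedType.Exports.

Local Open Scope classical_set_scope.
Local Open Scope ring_scope.

Definition symmetric_about_zero (R : realType) (F : R -> R) :=
  forall x, F (- x) = 1 - F x.

(* [m] is a median of the distribution with distribution function [G]:
   Pr(X < m) <= 1/2 <= Pr(X <= m). *)
Definition is_median (R : realType) (G : R -> R) (m : R) :=
  (forall x, x < m -> G x <= 2^-1) /\ 2^-1 <= G m.

Definition mutually_independent d (T : measurableType d) (R : realType)
    (P : probability T R) (n : nat) (X : 'I_n -> {RV P >-> R}) :=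
  forall (J : {set 'I_n}) (A : 'I_n -> set R),
    (forall i, measurable (A i)) ->
    P (\bigcap_(i in [set` J]) X i @^-1` A i) =
    (\prod_(i in J) P (X i @^-1` A i))%E.

Definition iid_with_cdf d (T : measurableType d) (R : realType)
    (P : probability T R) (n : nat) (X : 'I_n -> {RV P >-> R}) (F : R -> R) :=
  mutually_independent X /\ forall i x, cdf (X i) x = (F x)%:E.

Definition contaminated (R : realType) (F G : R -> R) (eps mu x : R) : R :=
  (1 - eps) * F x + eps * G (x - mu).

(* [Num.sg] is 0 at 0; for continuous distribution functions this differs from
   a sign valued in {-1, 1} only on a null event, so S has the same law. *)
Definition sign_statistic d (T : measurableType d) (R : realType)
    (P : probability T R) (n : nat) (X : 'I_n -> {RV P >-> R}) : T -> R :=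
  fun t => \sum_(i < n) Num.sg (X i t).

Section sign_statistic_measurable.
Context d (T : measurableType d) (R : realType) (P : probability T R) (n : nat).
Variable X : 'I_n -> {RV P >-> R}.

Let measurable_sign_statistic : measurable_fun [set: T] (sign_statistic X).
Proof.
apply: measurable_sum => i.
have sg_nd : {homo (@Num.sg R) : x y / x <= y}.
  move=> x y xy; case: (sgrP y) => [y0|y0|y0].
  - by rewrite sgr_le0 -y0.
  - by case: (sgrP x) => _; rewrite ?ler01 ?lexx ?(le_trans lerN10) ?ler01.
  - by rewrite ltr0_sg ?(le_lt_trans xy).
apply: measurableT_comp => //.
by apply: nondecreasing_measurable.
Qed.

HB.instance Definition _ :=
  isMeasurableFun.Build _ _ _ _ (sign_statistic X) measurable_sign_statistic.

End sign_statistic_measurable.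

(* Normalized so that the maximal value is 2. *)
Definition tv_dist d (T : measurableType d) (R : realType)
    (P Q : probability T R) : \bar R :=
  (2%:E * ereal_sup [set `|P A - Q A| | A in measurable])%E.

(* [law0 n] and [law1 n] are the laws of the test statistic under the null and
   the alternative hypotheses at sample size [n]. *)
Definition asymptotically_powerful d (T : measurableType d) (R : realType)
    (law0 law1 : nat -> probability T R) :=
  tv_dist (law0 n) (law1 n) @[n --> \oo] --> 2%:E.

Definition asymptotically_powerless d (T : measurableType d) (R : realType)
    (law0 law1 : nat -> probability T R) :=
  tv_dist (law0 n) (law1 n) @[n --> \oo] --> 0%E.

(* Main.v *)
Require Import Defs.
From mathcomp Require Import all_boot all_order all_algebra ring lra.
From mathcomp Require Import all_classical all_reals all_analysis.
From mathcomp Require Import measurable_realfun.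

Set Implicit Arguments.
Unset Strict Implicit.
Unset Printing Implicit Defensive.

Import Order.TTheory GRing.Theory Num.Theory.
Import numFieldNormedType.Exports.

Local Open Scope classical_set_scope.
Local Open Scope ring_scope.

(* At sample size n the signs are i.i.d. and the positive ones have probability
   1/2 + delta, where delta = 0 under the null hypothesis and
   delta = eps_n (1/2 - G(-mu_n)) under the alternative; hence the law of S is a
   finite sum over sign vectors and rate_n = sqrt n * delta.
   If rate_n -> oo, Chebyshev's inequality shows that the event S < n delta has
   probability at least 1 - 1 / rate_n^2 under the null and at most 1 / rate_n^2
   under the alternative.
   If rate_n -> 0, the chi-squared divergence between the two laws of the sign
   vector is (1 + 4 delta^2)^n - 1 <= exp (4 rate_n^2) - 1 -> 0, and it
   controls the total variation distance. *)

(** * Finite product laws on sign vectors: moments, tail bound and chi-squared bound *)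

Section SignVectors.
Variables (R : realFieldType) (n : nat).
Implicit Types (delta : R) (a : 'I_3) (f : {ffun 'I_n -> 'I_3}).

(* The index a : 'I_3 encodes the sign a - 1. *)
Definition sign_val a : R := a%:R - 1.

(* The values at the signs -1, 0, 1 are 1/2 - delta, 0 and 1/2 + delta. *)
Definition sign_mass delta a : R := sign_val a ^+ 2 / 2 + delta * sign_val a.

Definition vec_mass delta f : R := \prod_i sign_mass delta (f i).

Definition vec_sum f : R := \sum_i sign_val (f i).

Lemma sum_sign (h : 'I_3 -> R) :
  \sum_a h a = h ord0 + h (inord 1) + h ord_max.
Proof.
rewrite !big_ord_recl big_ord0 addr0 addrA; congr (_ + h _ + h _);
  by apply/val_inj; rewrite /= ?inordK.
Qed.

Lemma sign_val0 : sign_val ord0 = -1. Proof. by rewrite /sign_val sub0r. Qed.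
Lemma sign_val1 : sign_val (inord 1) = 0.
Proof. by rewrite /sign_val inordK// subrr. Qed.
Lemma sign_val2 : sign_val ord_max = 1.
Proof. by rewrite /sign_val /=; ring. Qed.
Definition sign_valE := (sign_val0, sign_val1, sign_val2).

Lemma sign_val_cube a : sign_val a ^+ 3 = sign_val a.
Proof.
case: a => [[|[|[|//]]] ?]; rewrite /sign_val /=; ring.
Qed.

Lemma sign_mass_ge0 delta a : `|delta| <= 1 / 2 -> 0 <= sign_mass delta a.
Proof.
rewrite ler_norml => /andP[? ?].
case: a => [[|[|[|//]]] ?]; rewrite /sign_mass /sign_val /=; lra.
Qed.

Lemma vec_mass_ge0 delta f : `|delta| <= 1 / 2 -> 0 <= vec_mass delta f.
Proof. by move=> ?; apply: prodr_ge0 => i _; exact: sign_mass_ge0. Qed.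

(** Independence of the coordinates in algebraic form: expanding the product of sums gives one term
    per sign vector. *)
Lemma expectation_prod delta (g : 'I_n -> 'I_3 -> R) :
  \sum_f vec_mass delta f * \prod_i g i (f i) =
  \prod_i \sum_a sign_mass delta a * g i a.
Proof.
rewrite bigA_distr_bigA; apply: eq_bigr => f _.
by rewrite -big_split.
Qed.

Lemma vec_mass_total delta : \sum_f vec_mass delta f = 1.
Proof.
transitivity (\sum_f vec_mass delta f * \prod_(i < n) 1).
  by apply: eq_bigr => f _; rewrite big1_eq mulr1.
rewrite (expectation_prod delta (fun _ _ => 1)) big1// => i _.
by rewrite sum_sign /sign_mass !sign_valE; field.
Qed.

(** A single sign has mean [2 * delta] and square 1, hence variance [1 - 4 * delta ^+ 2]; in the
    expanded square, only the diagonal terms survive. *)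
Lemma vec_sum_variance delta :
  \sum_f vec_mass delta f * (vec_sum f - n%:R * (2 * delta)) ^+ 2 =
  n%:R * (1 - 4 * delta ^+ 2).
Proof.
pose u a := sign_val a - 2 * delta.
have uE f : (vec_sum f - n%:R * (2 * delta)) ^+ 2 =
    \sum_i \sum_j u (f i) * u (f j).
  rewrite -big_distrlr /= -expr2 sumrB sumr_const card_ord.
  by rewrite mulr_natl.
(* Padding with factors 1 turns [u (f i) * u (f j)] into a product over all coordinates, the form
   that [expectation_prod] requires; for [i = j] the factor is [u a ^+ 2]. *)
pose g (i j k : 'I_n) a : R :=
  (if k == i then u a else 1) * (if k == j then u a else 1).
have gE i j f : u (f i) * u (f j) = \prod_k g i j k (f k).
  by rewrite big_split /= -!big_mkcond /= !big_pred1_eq.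
under eq_bigr do rewrite uE mulr_sumr.
rewrite exchange_big /=.
transitivity (\sum_(i < n) (1 - 4 * delta ^+ 2)); last first.
  by rewrite sumr_const card_ord [in RHS](mulr_natl _ n).
apply: eq_bigr => i _.
under eq_bigr do rewrite mulr_sumr.
rewrite exchange_big /= (bigD1 i)//= [X in _ + X]big1 ?addr0 => [|j ji].
  under eq_bigr do rewrite gE.
  rewrite expectation_prod (bigD1 i)//=.
  rewrite [X in _ * X]big1 ?mulr1 => [|k /negbTE ki];
    by rewrite sum_sign /g /u /sign_mass ?eqxx ?ki !sign_valE; field.
(* Off the diagonal, the factor at coordinate [i] is the mean of the centred sign [u], which is
   0. *)
under eq_bigr do rewrite gE.
rewrite expectation_prod (bigD1 i)//=.
rewrite sum_sign /g /u /sign_mass eqxx eq_sym (negbTE ji) !sign_valE.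
by rewrite [X in X * _](_ : _ = 0) ?mul0r//; field.
Qed.

(** Chebyshev's inequality, with the variance bounded by [n]. *)
Lemma vec_sum_chebyshev delta (t : R) (Q : pred {ffun 'I_n -> 'I_3}) :
  `|delta| <= 1 / 2 -> 0 < t ->
  (forall f, Q f -> t <= `|vec_sum f - n%:R * (2 * delta)|) ->
  \sum_(f | Q f) vec_mass delta f <= n%:R / t ^+ 2.
Proof.
move=> hd t0 Qt; rewrite ler_pdivlMr ?exprn_gt0// mulr_suml.
apply: (@le_trans _ _ (n%:R * (1 - 4 * delta ^+ 2))); last first.
  by rewrite ler_piMr// gerBl mulr_ge0// sqr_ge0.
rewrite -vec_sum_variance [leLHS]big_mkcond; apply: ler_sum => f _.
case: ifPn => [/Qt tf|_]; last by rewrite mulr_ge0 ?vec_mass_ge0 ?sqr_ge0.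
rewrite ler_wpM2l ?vec_mass_ge0// -[leRHS]real_normK ?num_real//.
by rewrite lerXn2r ?nnegrE// ltW.
Qed.

(** The likelihood ratio of the law with parameter [delta] to the symmetric law. *)
Definition vec_ratio delta f : R := \prod_i (1 + 2 * delta * sign_val (f i)).

Lemma vec_mass_ratio delta f :
  vec_mass delta f = vec_mass 0 f * vec_ratio delta f.
Proof.
rewrite /vec_mass /vec_ratio -big_split /=; apply: eq_bigr => i _.
(* The product [x ^+ 2 / 2 * (1 + 2 * delta * x)] has linear part [delta * x ^+ 3], and
   [x ^+ 3 = x]. *)
have := sign_val_cube (f i); rewrite /sign_mass; move: (sign_val _) => x xE.
by rewrite -[X in delta * X]xE; field.
Qed.

(** The ratio has mean 1, and its second moment factorizes with [1 + 4 * delta ^+ 2] for each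
    coordinate. *)
Lemma vec_ratio_chi2 delta :
  \sum_f vec_mass 0 f * (vec_ratio delta f - 1) ^+ 2 =
  (1 + 4 * delta ^+ 2) ^+ n - 1.
Proof.
transitivity (\sum_f (vec_mass 0 f * vec_ratio delta f ^+ 2
    - 2 * vec_mass delta f + vec_mass 0 f)).
  by apply: eq_bigr => f _; rewrite (vec_mass_ratio delta); ring.
rewrite !big_split /= sumrN -mulr_sumr !vec_mass_total.
under eq_bigr do rewrite -prodrXl.
rewrite (expectation_prod _ (fun _ a => (1 + 2 * delta * sign_val a) ^+ 2)).
under eq_bigr do rewrite sum_sign /sign_mass !sign_valE.
rewrite prodr_const card_ord.
set x := (X in X ^+ n).
have -> : x = 1 + 4 * delta ^+ 2 by rewrite /x; field.
ring.
Qed.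

(** A substitute for Cauchy-Schwarz that avoids square roots: the free parameter [e] balances the
    two terms. *)
Lemma vec_mass_dist delta (e : R) (Q : pred {ffun 'I_n -> 'I_3}) : 0 < e ->
  `|\sum_(f | Q f) vec_mass 0 f - \sum_(f | Q f) vec_mass delta f| <=
  e / 2 + ((1 + 4 * delta ^+ 2) ^+ n - 1) / (2 * e).
Proof.
move=> e0; rewrite -sumrB; apply: le_trans (ler_norm_sum _ _ _) _.
have -> : e / 2 = \sum_f vec_mass 0 f * (e / 2).
  by rewrite -mulr_suml vec_mass_total mul1r.
rewrite -vec_ratio_chi2 mulr_suml -big_split /= [leLHS]big_mkcond.
have m0 f : 0 <= vec_mass 0 f by rewrite vec_mass_ge0// normr0; lra.
apply: ler_sum => f _.
set y := vec_ratio delta f - 1.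
(* AM-GM: 2 |y| <= e + y^2 / e *)
rewrite [leRHS](_ : _ = vec_mass 0 f * ((e ^+ 2 + `|y| ^+ 2) / (2 * e)));
  last by rewrite real_normK ?num_real//; field; rewrite gt_eqF.
case: ifPn => _; last first.
  by rewrite mulr_ge0// divr_ge0 ?addr_ge0 ?sqr_ge0// mulr_ge0// ltW.
rewrite (vec_mass_ratio delta) distrC [X in `|X|](_ : _ = vec_mass 0 f * y);
  last by rewrite /y; ring.
rewrite normrM ger0_norm// ler_wpM2l// ler_pdivlMr ?mulr_gt0//.
by have := sqr_ge0 (e - `|y|); rewrite sqrrB; lra.
Qed.

End SignVectors.

(** * From i.i.d. observations to the finite law of the sign statistic *)

Section SignLaw.
Context d (T : measurableType d) (R : realType) (P : probability T R).

Definition sign_cell (a : 'I_3) : set R := [set x | Num.sg x = sign_val R a].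

Lemma sign_cell0 : sign_cell ord0 = `]-oo, 0[%classic.
Proof.
apply/seteqP; split=> x; rewrite /sign_cell /= in_itv /= sign_val0 => h.
  by rewrite -sgr_lt0 h ltrN10.
exact: ltr0_sg.
Qed.

Lemma sign_cell1 : sign_cell (inord 1) = [set 0].
Proof.
apply/seteqP; split=> x; rewrite /sign_cell /= sign_val1.
  by move/eqP; rewrite sgr_eq0 => /eqP.
by move=> ->; rewrite sgr0.
Qed.

Lemma sign_cell2 : sign_cell ord_max = `]0, +oo[%classic.
Proof.
apply/seteqP; split=> x; rewrite /sign_cell /= in_itv /= sign_val2 andbT => h.
  by rewrite -sgr_gt0 h ltr01.
exact: gtr0_sg.
Qed.

Lemma sign_cases (Q : 'I_3 -> Prop) :
  Q ord0 -> Q (inord 1) -> Q ord_max -> forall a, Q a.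
Proof.
move=> Q0 Q1 Q2 [[|[|[|//]]] h].
- by rewrite (_ : Ordinal h = ord0)//; exact: val_inj.
- by rewrite (_ : Ordinal h = inord 1)//; apply: val_inj; rewrite /= inordK.
- by rewrite (_ : Ordinal h = ord_max)//; exact: val_inj.
Qed.

Lemma measurable_sign_cell a : measurable (sign_cell a).
Proof.
by elim/sign_cases: a; rewrite ?sign_cell0 ?sign_cell1 ?sign_cell2.
Qed.

(** Continuity at 0 excludes an atom there, so the negative half-line has mass [H 0] and the
    positive one [1 - H 0]. *)
Lemma prob_sign_cell (X : {RV P >-> R}) (H : R -> R) (delta : R) a :
  (forall x, cdf X x = (H x)%:E) -> {for 0, continuous H} ->
  H 0 = 1 / 2 - delta ->
  P (X @^-1` sign_cell a) = (sign_mass delta a)%:E.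
Proof.
move=> HX Hc H0.
have cdfE x : distribution P X `]-oo, x] = (H x)%:E by rewrite -HX.
have atom0 : distribution P X [set 0] = 0%E.
  apply/eqP; rewrite eq_le measure_ge0 andbT; apply/lee_addgt0Pr => e e0.
  rewrite add0e.
  move/cvgrPdist_le : Hc => /(_ e e0) /nbhs_ballP[r /= r0 hr].
  have /hr : ball (0 : R) r (- (r / 2)).
    by rewrite /ball /= sub0r opprK ger0_norm; lra.
  (* A point just left of 0: the atom lies in the interval from [x] to 0, whose mass [H 0 - H x] is
     at most [e]. *)
  set x := - (r / 2) => Hx.
  have x0 : x < 0 by rewrite /x; lra.
  apply: (@le_trans _ _ (distribution P X (`]-oo, 0] `\` `]-oo, x]))).
    apply: le_measure; rewrite ?inE//; first exact: measurableD.
    by move=> y -> /=; rewrite !in_itv /= lexx; split=> //; rewrite leNgt x0.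
  rewrite measureD//; last by rewrite (le_lt_trans (probability_le1 _ _)) ?ltry.
  rewrite setIidr; last first.
    by move=> y /=; rewrite !in_itv /= => /le_trans; apply; exact: ltW.
  rewrite [X in (X - _ <= _)%E]cdfE [X in (_ - X <= _)%E]cdfE.
  by rewrite lee_fin (le_trans _ Hx)// ler_norm.
have -> : P (X @^-1` sign_cell a) = distribution P X (sign_cell a) by [].
elim/sign_cases: a; rewrite ?sign_cell0 ?sign_cell1 ?sign_cell2
  /sign_mass ?sign_val0 ?sign_val1 ?sign_val2.
- rewrite -(setDitv1r _ _ false) measureD//; last first.
    by rewrite (le_lt_trans (probability_le1 _ _)) ?ltry.
  rewrite [X in (X - _)%E]cdfE (_ : _ `&` _ = [set 0]); last first.
    by apply/seteqP; split=> [x []//|x -> /=]; rewrite in_itv /= lexx.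
  by rewrite [X in (_ - X)%E]atom0 sube0 H0; congr EFin; field.
- by rewrite atom0 expr0n /= mul0r mulr0 addr0.
- rewrite -setCitvl probability_setC// [X in (_ - X)%E]cdfE H0 -EFinB.
  by congr EFin; field.
Qed.

(** The sample space splits into finitely many disjoint cells, one per sign vector; the statistic is
    constant on each, and independence gives its mass. *)
Lemma distribution_sign_statistic n (X : 'I_n -> {RV P >-> R}) (H : R -> R)
    (delta : R) (A : set R) :
  iid_with_cdf X H -> {for 0, continuous H} -> H 0 = 1 / 2 - delta ->
  distribution P (sign_statistic X) A =
  (\sum_(f : {ffun 'I_n -> 'I_3} | vec_sum R f \in A) vec_mass delta f)%:E.
Proof.
move=> [indep HX] Hc H0.
(* The intersection runs over the full index set in the form used by [mutually_independent]. *)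
pose cell (f : {ffun 'I_n -> 'I_3}) :=
  \bigcap_(i in [set` [set: 'I_n]%SET]) X i @^-1` sign_cell (f i).
have cellP f t : cell f t <-> forall i, Num.sg (X i t) = sign_val R (f i).
  split=> [h i|h i _]; last exact: h.
  by have /(_ _)/= := h i; rewrite inE; apply.
have sign_val_inj : injective (sign_val R).
  by move=> a b /addIr /eqP; rewrite eqr_nat => /eqP/val_inj.
have cell_mass f : P (cell f) = (vec_mass delta f)%:E.
  rewrite indep => [|i]; last exact: measurable_sign_cell.
  rewrite -prodEFin; apply: eq_big => [i|i _]; first by rewrite inE.
  exact: prob_sign_cell.
have cell_measurable f : measurable (cell f).
  apply: fin_bigcap_measurable => // i _.
  rewrite -[X in measurable X]setTI; apply: measurable_funPT => //.
  exact: measurable_sign_cell.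
pose r := enum [pred f : {ffun 'I_n -> 'I_3} | vec_sum R f \in A].
have preimE : sign_statistic X @^-1` A = \bigcup_(f in [set` r]) cell f.
  apply/seteqP; split=> t /=.
    have sg_cell i : exists a : 'I_3, Num.sg (X i t) = sign_val R a.
      case: (sgrP (X i t)) => _; [exists (inord 1)|exists ord_max|exists ord0];
        by rewrite ?sign_val0 ?sign_val1 ?sign_val2.
    move=> At; have [g gE] := choice sg_cell.
    exists (finfun g) => [/=|]; last by apply/cellP => i; rewrite ffunE gE.
    rewrite mem_enum inE.
    rewrite [vec_sum _ _](_ : _ = sign_statistic X t)//.
    by apply: eq_bigr => i _; rewrite ffunE gE.
  move=> [f /=]; rewrite mem_enum inE => Af /cellP ft.
  by rewrite /sign_statistic (eq_bigr _ (fun i _ => ft i)).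
transitivity (P (sign_statistic X @^-1` A)) => //.
rewrite preimE measure_fin_bigcup//; last first.
  move=> f g _ _ [t [/cellP ft /cellP gt]]; apply/ffunP => i.
  by apply: sign_val_inj; rewrite -ft -gt.
rewrite -fsbig_seq ?enum_uniq//= big_enum -sumEFin /=.
exact: eq_bigr.
Qed.

End SignLaw.

(** * Elementary bounds on the total variation distance *)

Section TotalVariation.
Context d (T : measurableType d) (R : realType) (P Q : probability T R).

Lemma tv_dist_le (c : R) :
  (forall A, measurable A -> (`|P A - Q A| <= c%:E)%E) ->
  (tv_dist P Q <= (2 * c)%:E)%E.
Proof.
move=> h; rewrite /tv_dist EFinM lee_wpmul2l ?lee_fin//.
by apply: ge_ereal_sup => _ [A mA <-]; exact: h.
Qed.

Lemma tv_dist_ge A : measurable A -> (2%:E * `|P A - Q A| <= tv_dist P Q)%E.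
Proof.
move=> mA; rewrite lee_wpmul2l ?lee_fin//.
by apply: ereal_sup_ubound; exists A.
Qed.

Lemma tv_dist_ge0 : (0 <= tv_dist P Q)%E.
Proof.
apply: le_trans (tv_dist_ge measurable0).
by rewrite mule_ge0 ?abse_ge0 ?lee_fin.
Qed.

Lemma tv_dist_le2 : (tv_dist P Q <= 2%:E)%E.
Proof.
rewrite -[2]mulr1; apply: tv_dist_le => A mA.
have PA := probability_le1 P mA; have QA := probability_le1 Q mA.
have := fine_ge0 (measure_ge0 P A); have := fine_ge0 (measure_ge0 Q A).
rewrite -(fineK (fin_num_measure P A mA)) in PA *.
rewrite -(fineK (fin_num_measure Q A mA)) in QA *.
rewrite !lee_fin in PA QA; rewrite -EFinB abse_EFin lee_fin ler_norml /= => ? ?.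
by apply/andP; split; lra.
Qed.

Lemma tv_dist_fin_num : tv_dist P Q \is a fin_num.
Proof.
by rewrite ge0_fin_numE ?tv_dist_ge0// (le_lt_trans tv_dist_le2) ?ltry.
Qed.

End TotalVariation.

(** * Total variation bounds at a fixed sample size *)

Section SignTest.
Context (R : realType) (n : nat) (delta : R).
Variables P Q : probability R R.
Hypothesis PE : forall A, P A =
  (\sum_(f : {ffun 'I_n -> 'I_3} | vec_sum R f \in A) vec_mass 0 f)%:E.
Hypothesis QE : forall A, Q A =
  (\sum_(f : {ffun 'I_n -> 'I_3} | vec_sum R f \in A) vec_mass delta f)%:E.

Lemma sign_test_tv_ge : (0 < n)%N -> 0 < delta <= 1 / 2 ->
  ((2 - 4 / (n%:R * delta ^+ 2))%:E <= tv_dist P Q)%E.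
Proof.
move=> n0 /andP[d0 d1]; have n0' : 0 < n%:R :> R by rewrite ltr0n.
have t0 : 0 < n%:R * delta by rewrite mulr_gt0.
(* The threshold lies halfway between the means 0 and [n%:R * (2 * delta)], so each error is a
   deviation of at least [n%:R * delta]. *)
pose A : set R := [set` `]-oo, n%:R * delta[].
have AE f : (vec_sum R f \in A) = (@vec_sum R n f < n%:R * delta).
  by apply/idP/idP; rewrite inE /A /= in_itv.
have nt : n%:R / (n%:R * delta) ^+ 2 = 1 / (n%:R * delta ^+ 2).
  by field; rewrite !gt_eqF.
have normd : `|delta| <= 1 / 2 by rewrite gtr0_norm.
have norm0 : `|0 : R| <= 1 / 2 by rewrite normr0; lra.
have Qle : \sum_(f : {ffun 'I_n -> 'I_3} | vec_sum R f \in A) vec_mass delta f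
    <= 1 / (n%:R * delta ^+ 2).
  rewrite -nt; apply: vec_sum_chebyshev => // f; rewrite AE => fA.
  by rewrite ler_normr; apply/orP; right; lra.
have Pge : 1 - 1 / (n%:R * delta ^+ 2) <=
    \sum_(f : {ffun 'I_n -> 'I_3} | vec_sum R f \in A) vec_mass 0 f.
  rewrite lerBlDr -[leLHS](vec_mass_total n (0 : R)).
  rewrite (bigID (fun f => vec_sum R f \in A)) /= lerD2l -nt.
  apply: vec_sum_chebyshev => // f.
  by rewrite AE -leNgt !mulr0 subr0 => /le_trans; apply; exact: ler_norm.
apply: le_trans (tv_dist_ge P Q (A := A) _); last exact: measurable_itv.
rewrite PE QE -EFinB abse_EFin -EFinM lee_fin.
move: Pge Qle; rewrite !div1r; move: (n%:R * _)^-1 => x.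
set p := \sum_(f | _) vec_mass 0 f; set q := \sum_(f | _) vec_mass delta f.
by have := ler_norm (p - q); lra.
Qed.

Lemma sign_test_tv_le (e : R) : 0 < e ->
  (tv_dist P Q <= (e + ((1 + 4 * delta ^+ 2) ^+ n - 1) / e)%:E)%E.
Proof.
move=> e0.
rewrite [X in (_ <= X%:E)%E](_ : _ =
    2 * (e / 2 + ((1 + 4 * delta ^+ 2) ^+ n - 1) / (2 * e))).
  by apply: tv_dist_le => A _; rewrite PE QE lee_fin; exact: vec_mass_dist.
by field; rewrite gt_eqF.
Qed.

End SignTest.

(** * Passage to the limit in the sample size *)

Lemma normr_sub2_fine_tv_le d (T : measurableType d) (R : realType)
    (P Q : probability T R) (e : R) :
  ((2 - e)%:E <= tv_dist P Q)%E -> `|2 - fine (tv_dist P Q)| <= e.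
Proof.
have := tv_dist_le2 P Q; rewrite -(fineK (tv_dist_fin_num P Q)) !lee_fin /=.
by move=> *; rewrite ger0_norm; lra.
Qed.

Theorem proposition5 (R : realType)
    (F G : cumulativeBounded (0 : R) (1 : R)) (eps mu : nat -> R)
    (F_continuous : continuous F) (F_symmetric : symmetric_about_zero F)
    (G_continuous : continuous G) (G_median : is_median G 0)
    (eps_range : forall n, 0 < eps n <= 1)
    (eps_cvg : eps n @[n --> \oo] --> (0 : R))
    (mu_pos : forall n, 0 < mu n)
    (d0 d1 : nat -> measure_display)
    (T0 : forall n, measurableType (d0 n))
    (T1 : forall n, measurableType (d1 n))
    (P0 : forall n, probability (T0 n) R)
    (P1 : forall n, probability (T1 n) R)
    (X0 : forall n, 'I_n -> {RV (P0 n) >-> R})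
    (X1 : forall n, 'I_n -> {RV (P1 n) >-> R})
    (H0 : forall n, iid_with_cdf (X0 n) F)
    (H1 : forall n, iid_with_cdf (X1 n) (contaminated F G (eps n) (mu n))) :
  let law0 n := distribution (P0 n) (sign_statistic (X0 n)) in
  let law1 n := distribution (P1 n) (sign_statistic (X1 n)) in
  let rate n := Num.sqrt (n%:R : R) * eps n * (2^-1 - G (- mu n)) in
  (rate n @[n --> \oo] --> +oo -> asymptotically_powerful law0 law1) /\
  (rate n @[n --> \oo] --> (0 : R) -> asymptotically_powerless law0 law1).
Proof.
move=> law0 law1 rate.
pose delta n := eps n * (2^-1 - G (- mu n)).
have F0 : F 0 = 1 / 2 by have := F_symmetric 0; rewrite oppr0; lra.
have law0E n A : law0 n A =
    (\sum_(f : {ffun 'I_n -> 'I_3} | vec_sum R f \in A) vec_mass 0 f)%:E.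
  apply: distribution_sign_statistic (H0 n) _ _; first exact: F_continuous.
  by rewrite F0 subr0.
have C0 n : contaminated F G (eps n) (mu n) 0 = 1 / 2 - delta n.
  by rewrite /contaminated /delta sub0r F0; field.
have law1E n A : law1 n A = (\sum_(f : {ffun 'I_n -> 'I_3} | vec_sum R f \in A)
    vec_mass (delta n) f)%:E.
  apply: distribution_sign_statistic (H1 n) _ (C0 n).
  apply: (@continuousD _ _ _ (fun x => (1 - eps n) * F x)
    (fun x => eps n * G (x - mu n))).
    by apply: continuousM; [exact: cst_continuous|exact: F_continuous].
  apply: continuousM; first exact: cst_continuous.
  apply: (@continuous_comp _ _ _ (fun x => x - mu n) G).
    by apply: continuousB; [exact: cvg_id|exact: cst_continuous].
  exact: G_continuous.
(* Here [1 / 2 - delta n] is a value of the distribution function of an actual observation, hence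
   nonnegative; [0 < n] supplies that observation. *)
have delta_le n : (0 < n)%N -> delta n <= 1 / 2.
  move=> n0; rewrite -subr_ge0 -C0 -lee_fin.
  by have [_ /(_ (Ordinal n0) 0) <-] := H1 n; exact: cdf_ge0.
have rateE n : rate n = Num.sqrt n%:R * delta n by rewrite /rate mulrA.
have rate_sqr n : n%:R * delta n ^+ 2 = rate n ^+ 2.
  by rewrite rateE [RHS]exprMn sqr_sqrtr.
split=> rate_cvg.
- apply/fine_cvgP; split; first by apply: nearW => n; exact: tv_dist_fin_num.
  apply/cvgrPdist_le => e e0.
  (* The 1 ensures [rate n <= rate n ^+ 2] and forces [n] and [delta n] to be positive; the [4 / e]
     then makes the loss [4 / rate n ^+ 2] at most [e]. *)
  have /cvgryPge/(_ (1 + 4 / e)) := rate_cvg.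
  apply: filterS => n big_rate.
  have e4 : 0 < 4 / e by rewrite divr_gt0.
  have rate_gt1 : 1 < rate n by lra.
  have n0 : (0 < n)%N.
    rewrite lt0n; apply/eqP => n0; move: rate_gt1.
    by rewrite rateE n0 sqrtr0 mul0r ltr10.
  have delta0 : 0 < delta n.
    have : 0 < rate n by lra.
    by rewrite rateE pmulr_rgt0// sqrtr_gt0 ltr0n.
  apply: normr_sub2_fine_tv_le.
  have d01 : 0 < delta n <= 1 / 2 by rewrite delta0 delta_le.
  apply: le_trans (sign_test_tv_ge (law0E n) (law1E n) n0 d01).
  rewrite lee_fin rate_sqr lerD2l lerN2 ler_pdivrMr ?exprn_gt0//; last lra.
  rewrite mulrC -ler_pdivrMr//.
  by apply: (@le_trans _ _ (rate n)); [lra|rewrite expr2 ler_peMl; lra].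
- apply/fine_cvgP; split; first by apply: nearW => n; exact: tv_dist_fin_num.
  apply/cvgrPdist_le => e e0.
  have chi2_cvg : expR (4 * rate n ^+ 2) @[n --> \oo] --> (1 : R).
    have expR4 : expR (4 * (0 * 0)) = 1 :> R by rewrite !mulr0 expR0.
    rewrite -[X in _ --> X]expR4.
    apply: continuous_cvg; first exact: continuous_expR.
    by apply: cvgM; [exact: cvg_cst|exact: cvgM].
  (* With parameter [e / 2] in [sign_test_tv_le], a divergence of at most [(e / 2) ^+ 2] contributes
     [e / 2]. *)
  have e2 : 0 < (e / 2) ^+ 2 by rewrite exprn_gt0// divr_gt0.
  have /cvgrPdist_le/(_ _ e2) := chi2_cvg.
  apply: filterS => n; rewrite distrC => /(le_trans (ler_norm _)) chi2_le.
  rewrite sub0r normrN ger0_norm ?fine_ge0 ?tv_dist_ge0//.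
  rewrite -lee_fin fineK ?tv_dist_fin_num//.
  have eh : 0 < e / 2 by lra.
  apply: le_trans (sign_test_tv_le (law0E n) (law1E n) eh) _.
  rewrite lee_fin [leRHS](splitr e) lerD2l ler_pdivrMr// -expr2.
  apply: le_trans chi2_le; rewrite lerD2r -rate_sqr.
  (* The exponential becomes an [n]-th power, so that [1 + x <= expR x] can be applied to each
     factor. *)
  rewrite [X in expR X]mulrCA (expRM_natl n).
  have chi0 : 0 <= 4 * delta n ^+ 2 by rewrite mulr_ge0// sqr_ge0.
  by rewrite lerXn2r ?nnegrE ?expR_ge0 ?expR_ge1Dx// addr_ge0.
Qed.
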